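(* Let $G$ be a finite simple graph and let $H$ be an empty (edgeless) graph of order $n$. If the lexicographic product $G\circ H$ is well-f-covered, then for every maximal forest $F$ of $G$, \[n\bigl(I(F)+K_{2}(F)+L(F)\bigr)+K_{2}(F)+L'(F)=f(G\circ H),\] where $I(F)$ is the number of isolated vertices of $F$, $K_{2}(F)$ is the number of connected components of $F$ isomorphic to $K_{2}$, $L(F)$ is the number of leaves (vertices of degree $1$) lying in components of $F$ that are not isomorphic to $K_2$, and $L'(F)$ is the number of vertices of degree at least $2$ in $F$.
   Context: All graphs are finite and simple. An empty graph is a graph with no edges. The lexicographic product $G\circ H$ has vertex set $V(G)\times V(H)$, with $(g,h)$ adjacent to $(g',h')$ if and only if either $g$ is adjacent to $g'$ in $G$, or $g=g'$ and $h$ is adjacent to $h'$ in $H$. A forest in a graph $G$ means an induced subgraph $G[X]$ ($X\subseteq V(G)$) containing no cycle; it is a maximal forest if no vertex set properly containing $X$ induces an acyclic subgraph. The forest number $f(G)$ is the maximum order of a forest in $G$. A graph is well-f-covered if all its maximal forests have the same order (necessarily $f(G)$). *)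

(* Defs.v *)
From HB Require Import structures.
From mathcomp Require Import all_boot.

Set Implicit Arguments.
Unset Strict Implicit.
Unset Printing Implicit Defensive.

Record sgraph := SGraph {
  vertex :> finType;
  adj : rel vertex;
  adj_sym : symmetric adj;
  adj_irrefl : irreflexive adj }.

Arguments adj {s} _ _.

Definition edgeless (G : sgraph) : Prop := forall x y : G, ~~ adj x y.

Section CompleteGraph.
Variable n : nat.
Definition complete_adj : rel 'I_n := fun x y => x != y.
Lemma complete_adj_sym : symmetric complete_adj.
Proof. by move=> x y; rewrite /complete_adj eq_sym. Qed.
Lemma complete_adj_irrefl : irreflexive complete_adj.
Proof. by move=> x; rewrite /complete_adj eqxx. Qed.
Definition complete_graph := SGraph complete_adj_sym complete_adj_irrefl.
End CompleteGraph.

Section LexProduct.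
Variables G H : sgraph.
Definition lex_adj : rel (G * H)%type :=
  fun u v => adj u.1 v.1 || (u.1 == v.1) && adj u.2 v.2.
Lemma lex_adj_sym : symmetric lex_adj.
Proof.
by move=> u v; rewrite /lex_adj adj_sym eq_sym (adj_sym u.2).
Qed.
Lemma lex_adj_irrefl : irreflexive lex_adj.
Proof. by move=> u; rewrite /lex_adj !adj_irrefl andbF. Qed.
Definition lex_product := SGraph lex_adj_sym lex_adj_irrefl.
End LexProduct.

Section Induced.
Variables (G : sgraph) (X : {set G}).
Definition induced_adj : rel {x : G | x \in X} := fun x y => adj (val x) (val y).
Lemma induced_adj_sym : symmetric induced_adj.
Proof. by move=> x y; apply: adj_sym. Qed.
Lemma induced_adj_irrefl : irreflexive induced_adj.
Proof. by move=> x; apply: adj_irrefl. Qed.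
Definition induced := SGraph induced_adj_sym induced_adj_irrefl.
End Induced.

Definition graph_iso (G H : sgraph) : bool :=
  [exists f : {ffun G -> H},
     [&& injectiveb f, [forall y, exists x, f x == y]
       & [forall x, forall y, adj (f x) (f y) == adj x y]]].

Lemma graph_isoP (G H : sgraph) :
  reflect (exists2 f : G -> H,
             bijective f & forall x y, adj (f x) (f y) = adj x y)
          (graph_iso G H).
Proof.
apply: (iffP existsP) => [[f /and3P[/injectiveP injf surjf homf]]|[f bijf homf]].
  exists f; last by move=> x y; apply/eqP/(forallP (forallP homf x)).
  have surjP y : exists x, f x == y by apply/existsP/(forallP surjf).
  exists (fun y => xchoose (surjP y)) => [x|y].
    by apply: injf; apply/eqP; exact: xchooseP (surjP (f x)).
  by apply/eqP; exact: xchooseP (surjP y).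
exists [ffun x => f x]; apply/and3P; split.
- by apply/injectiveP => x y; rewrite !ffunE; apply: bij_inj.
- case: bijf => g _ gK; apply/forallP => y; apply/existsP; exists (g y).
  by rewrite ffunE gK.
- by apply/forallP => x; apply/forallP => y; rewrite !ffunE homf.
Qed.

Definition is_cycle (G : sgraph) (c : seq G) : bool :=
  (2 < size c) && ucycleb adj c.

(* A cycle repeats no vertex, so bounding its length by #|G| loses nothing
   (see acyclicP); the bound only makes the predicate boolean. *)
Definition acyclic (G : sgraph) : bool :=
  ~~ [exists k : 'I_#|G|.+1, exists c : k.-tuple G, is_cycle c].

Lemma acyclicP (G : sgraph) :
  reflect (forall c : seq G, ~~ is_cycle c) (acyclic G).
Proof.
apply: (iffP idP) => [acG c|noc].
  apply: contra acG => cc.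
  have uc : uniq c by case/andP: cc => _ /andP[].
  have sc : size c < #|G|.+1 by rewrite ltnS -(card_uniqP uc) max_card.
  apply/existsP; exists (Ordinal sc); apply/existsP.
  by exists (in_tuple c).
by apply/existsPn => k; apply/existsPn => c; apply: noc.
Qed.

Definition is_forest (G : sgraph) (X : {set G}) : bool := acyclic (induced X).

Definition maximal_forest (G : sgraph) (X : {set G}) : bool :=
  maxset (@is_forest G) X.

Definition forest_number (G : sgraph) : nat :=
  \max_(X : {set G} | is_forest X) #|X|.

Definition well_f_covered (G : sgraph) : Prop :=
  forall X Y : {set G}, maximal_forest X -> maximal_forest Y -> #|X| = #|Y|.

Section Counts.
Variable F : sgraph.

Definition degree (v : F) : nat := #|[set w : F | adj v w]|.

Definition component (v : F) : {set F} := [set w | connect adj v w].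

Definition components : {set {set F}} := [set component v | v : F].

Definition isK2 (C : {set F}) : bool := graph_iso (induced C) (complete_graph 2).

Definition num_isolated : nat := #|[set v : F | degree v == 0]|.

Definition num_K2 : nat := #|[set C in components | isK2 C]|.

Definition num_leaves : nat :=
  #|[set v : F | (degree v == 1) && ~~ isK2 (component v)]|.

Definition num_internal : nat := #|[set v : F | 2 <= degree v]|.

End Counts.

(* Main.v *)
(* Blow up a maximal forest F of G: replace by a full copy of H every isolated
   vertex, every leaf outside the K2 components, and one end of each K2
   component (the one selected by [root]), and keep a single copy of every
   other vertex. Blown-up vertices have degree at most 1 in the result, so no
   cycle meets them and any cycle would project to a cycle of F. The result is
   maximal: a new vertex over a vertex outside F closes a lift of a cycle of G,
   and a second copy of a vertex of F closes a 4-cycle. Its order is the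
   left-hand side of the identity, and well-f-coveredness makes it the forest
   number. *)

Require Import Defs.
From mathcomp Require Import all_boot.

Set Implicit Arguments.
Unset Strict Implicit.
Unset Printing Implicit Defensive.

(** * Cycles, forests and maximal forests *)

Lemma is_cycle_map (G G' : sgraph) (f : G -> G') (c : seq G) :
    {in c &, injective f} ->
    {in c &, forall x y, adj x y -> adj (f x) (f y)} ->
  is_cycle c -> is_cycle (map f c).
Proof.
move=> injf homf /and3P[sc cc uc]; apply/and3P; split.
- by rewrite size_map.
- rewrite cycle_map; apply: (sub_in_cycle (P := mem c)) cc; last exact/allP.
  by move=> x y xc yc /=; apply: homf.
- by rewrite map_inj_in_uniq.
Qed.

Section Cycles.
Variable G : sgraph.

Lemma is_cycle_rot (c : seq G) k : is_cycle (rot k c) = is_cycle c.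
Proof. by rewrite /is_cycle /ucycleb size_rot rot_cycle rot_uniq. Qed.

(** Rotate [c] to start at [v]: the second and the last entries are the two neighbours, distinct
    because [c] has length above 2 and no repetition. *)
Lemma is_cycle_neighbours (c : seq G) v : is_cycle c -> v \in c ->
  exists a b, [/\ a \in c, b \in c, a != b, adj v a & adj v b].
Proof.
move=> cc /rot_to[k s rot_c].
have mem_c x : (x \in c) = (x \in v :: s) by rewrite -rot_c mem_rot.
move: cc; rewrite -(is_cycle_rot c k) rot_c => /and3P[].
case: s mem_c {rot_c} => [|a s] // mem_c; case/lastP: s mem_c => [|s b] // mem_c _.
rewrite /= !rcons_path last_rcons => /and3P[va _ bv] /and3P[_ a_s _].
exists a, b; rewrite !mem_c !inE !mem_rcons !inE !eqxx !orbT va adj_sym bv.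
by split=> //; apply: contraNneq a_s => ->; rewrite mem_rcons inE eqxx.
Qed.

Lemma is_cycle4 (a b c d : G) : a != c -> b != d ->
  adj a b -> adj b c -> adj c d -> adj d a -> is_cycle [:: a; b; c; d].
Proof.
have neq x y : adj x y -> x != y by apply: contraTneq => ->; rewrite adj_irrefl.
move=> ac bd ab bc cd da; rewrite /is_cycle /ucycleb /= ab bc cd da !inE.
by rewrite !negb_or neq // ac eq_sym neq // neq // bd neq.
Qed.

Lemma is_forestP (X : {set G}) :
  reflect (forall c : seq G, {subset c <= X} -> ~~ is_cycle c) (is_forest X).
Proof.
apply: (iffP (acyclicP _)) => acX c; last first.
  have /negP noc : ~~ is_cycle (map val c : seq G).
    by apply: acX => x /mapP[y _ ->]; apply: valP.
  apply/negP => cc; apply: noc; apply: (@is_cycle_map (induced X) G val) cc => // x y _ _.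
  exact: val_inj.
(* A sequence of vertices of [X] is lifted entry by entry to the subtype on which [induced X]
   lives. *)
move=> cX; have [s ->] : exists s : seq (induced X), c = map val s.
  elim: c cX => [|x c IHc] cX; first by exists [::].
  have [s ->] := IHc (fun y yc => cX y (mem_behead (s := x :: c) yc)).
  by exists (Sub x (cX x (mem_head x c)) :: s).
apply: contra (acX s); rewrite /is_cycle /ucycleb size_map cycle_map.
by rewrite (map_inj_uniq val_inj).
Qed.

Lemma maximal_forest_card (X : {set G}) : well_f_covered G ->
  maximal_forest X -> #|X| = forest_number G.
Proof.
move=> wfc maxX; apply/eqP; rewrite eqn_leq; apply/andP; split.
  exact: leq_bigmax_cond (maxsetp maxX).
(* Every forest extends to a maximal one, which has the order of [X]. *)
apply/bigmax_leqP => Z forZ; have [W maxW ZW] := maxset_exists forZ.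
by rewrite (wfc X W maxX maxW) subset_leq_card.
Qed.

End Cycles.

(** * K2 components and the count of blown-up vertices *)

Section Counting.
Variable F : sgraph.
Implicit Types u v w : F.

Let symF : connect_sym (@adj F) := sym_connect_sym (@adj_sym F).

Lemma component_eqP u v :
  reflect (component u = component v) (root adj u == root adj v).
Proof.
rewrite (root_connect symF); apply: (iffP idP) => [uv | eq_uv].
  by apply/setP => w; rewrite !inE (same_connect symF uv).
have: v \in component v by rewrite inE connect0.
by rewrite -eq_uv inE.
Qed.

Lemma isK2_component v : isK2 (component v) ->
  exists w, [/\ adj v w, component v = [set v; w] & degree v = 1].
Proof.
case/graph_isoP => f bijf homf.
have C2 : #|component v| = 2.
  by rewrite -[RHS](card_ord 2) -(bij_eq_card bijf) card_sig.
have /cards2P[x [y [xy defC]]] : #|component v| == 2 by rewrite C2.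
have [xC yC] : x \in component v /\ y \in component v.
  by rewrite defC !inE !eqxx orbT.
have adjxy : adj x y.
  have := homf (Sub x xC) (Sub y yC); rewrite /= /complete_adj.
  by rewrite (inj_eq (bij_inj bijf)) -val_eqE /= xy => /esym.
have [w [vw defCv]] : exists w, adj v w /\ component v = [set v; w].
  have: v \in component v by rewrite inE connect0.
  rewrite {1}defC !inE => /orP[]/eqP Dv; [exists y | exists x].
    by rewrite defC Dv.
  by rewrite defC Dv adj_sym setUC.
exists w; split=> //; rewrite /degree; apply/eqP/cards1P; exists w.
apply/setP => z; rewrite !inE; apply/idP/eqP => [vz | -> //].
have: z \in component v by rewrite inE connect1.
by rewrite defCv !inE => /orP[]/eqP // Dz; rewrite Dz adj_irrefl in vz.
Qed.

Lemma degree1_uniq v a b : degree v <= 1 -> adj v a -> adj v b -> a = b.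
Proof. by move/card_le1_eqP => v1 va vb; apply: v1; rewrite inE. Qed.

(** Neither end has a neighbour besides the other, so [[set u; v]] is closed under adjacency and is
    the whole component. *)
Lemma degree1_isK2 u v :
  degree u <= 1 -> degree v <= 1 -> adj u v -> isK2 (component u).
Proof.
move=> du dv uv; have vu : adj v u by rewrite adj_sym.
have neq_uv : v != u by apply: contraTneq uv => ->; rewrite adj_irrefl.
have clC : closed adj [set u; v].
  apply: (intro_closed symF) => x y xy; rewrite !inE => /orP[]/eqP Dx; subst x.
    by rewrite (degree1_uniq du xy uv) eqxx orbT.
  by rewrite (degree1_uniq dv xy vu) eqxx.
have defC x : x \in component u -> x = u \/ x = v.
  rewrite inE => /(closed_connect clC); rewrite !inE eqxx /=.
  by move/esym/orP=> []/eqP; [left | right].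
have [uC vC] : u \in component u /\ v \in component u.
  by rewrite !inE connect0 connect1.
apply/graph_isoP.
exists (fun x : induced (component u) => if val x == u then ord0 else ord_max : 'I_2).
  exists (fun i : 'I_2 => if i == ord0 then Sub u uC else Sub v vC) => [x|i] /=.
    apply: val_inj; case: (defC _ (valP x)) => Dx; rewrite Dx ?eqxx //=.
    by rewrite (negPf neq_uv).
  by case: i => [[|[|//]]] Hi /=; rewrite ?eqxx ?(negPf neq_uv); apply: val_inj.
move=> [x xC] [y yC]; rewrite /= /complete_adj /induced_adj /=.
by case: (defC x xC) => ->; case: (defC y yC) => ->;
  rewrite ?eqxx ?(negPf neq_uv) ?adj_irrefl ?uv ?vu.
Qed.

Definition blown : {set F} :=
  [set v | (degree v <= 1) && (isK2 (component v) ==> (root adj v == v))].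

(** Adjacent vertices of degree at most 1 form a K2 component, and only its root is blown up. *)
Lemma blown_independent u v : u \in blown -> v \in blown -> ~~ adj u v.
Proof.
rewrite !inE => /andP[du ru] /andP[dv rv]; apply/negP => uv.
have vu : adj v u by rewrite adj_sym.
rewrite (degree1_isK2 du dv uv) in ru; rewrite (degree1_isK2 dv du vu) in rv.
have eq_uv : u = v.
  by rewrite -(eqP ru) -(eqP rv); apply/(rootP symF)/connect1.
by rewrite eq_uv adj_irrefl in uv.
Qed.

(** If [P] selects exactly one vertex in each K2 component, [component] is a bijection from the
    selected vertices to these components. *)
Lemma card_K2_pick (P : pred F) :
    (forall u v, isK2 (component u) -> component u = component v ->
       P u -> P v -> u = v) ->
    (forall u, isK2 (component u) ->
       exists2 v, component v = component u & P v) ->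
  #|[set v | isK2 (component v) && P v]| = num_K2 F.
Proof.
move=> injP surjP; rewrite -(card_in_imset (f := @component F)); last first.
  by move=> u v; rewrite !inE => /andP[ku pu] /andP[_ pv] /injP; apply.
apply: eq_card => C; rewrite inE; apply/imsetP/andP => [[v]|[/imsetP[u _ ->]]].
  by rewrite inE => /andP[kv _] ->; rewrite imset_f.
by move=> ku; have [v cv pv] := surjP u ku; exists v; rewrite ?inE cv ?ku.
Qed.

Lemma card_K2_root :
  #|[set v : F | isK2 (component v) && (root adj v == v)]| = num_K2 F.
Proof.
apply: card_K2_pick => [u v _ /component_eqP/eqP uv /eqP<- /eqP<- //|u _].
by exists (root adj u); [apply/component_eqP|]; rewrite root_root.
Qed.

Lemma card_K2_nonroot :
  #|[set v : F | isK2 (component v) && (root adj v != v)]| = num_K2 F.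
Proof.
have rootC u : root adj u \in component u by rewrite inE connect_root.
have memC u : u \in component u by rewrite inE connect0.
apply: card_K2_pick => [u v ku cuv ru rv | u ku].
  have [w [_ defC _]] := isK2_component ku.
  have eq_r : root adj u = root adj v by apply/eqP/component_eqP.
  have := memC v; rewrite -cuv defC !inE => /orP[/eqP-> //|/eqP Dv].
  have := rootC u; rewrite defC !inE (negPf ru) eq_r -Dv.
  by rewrite (negPf rv).
have [w [uw defC _]] := isK2_component ku.
have cwu : component w = component u.
  by apply/component_eqP; rewrite (root_connect symF) symF connect1.
have [ru|ru] := eqVneq (root adj u) u; last by exists u.
exists w => //; have /component_eqP/eqP-> := cwu; rewrite ru.
by apply: contraTneq uw => ->; rewrite adj_irrefl.
Qed.

Lemma card_set_sum (T : finType) (P : pred T) : #|[set x | P x]| = \sum_x P x.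
Proof. by rewrite -sum1dep_card big_mkcond; apply: eq_bigr => x; case: (P x). Qed.

Lemma card_blown : #|blown| = num_isolated F + num_K2 F + num_leaves F.
Proof.
rewrite -card_K2_root /num_isolated /num_leaves !card_set_sum -!big_split /=.
(* The identity holds vertex by vertex between indicators: in a K2 component the degree is 1 and
   only the root test matters; elsewhere only the degree does. *)
apply: eq_bigr => v _; have := @isK2_component v.
case: (isK2 _) => [[//|w [_ _ ->]]|_] /=; first by rewrite addn0.
by case: (degree v) => [|[]].
Qed.

Lemma card_blownC : #|~: blown| = num_K2 F + num_internal F.
Proof.
rewrite -card_K2_nonroot /num_internal !card_set_sum -big_split /=.
apply: eq_bigr => v _; rewrite inE; have := @isK2_component v.
case: (isK2 _) => [[//|w [_ _ ->]]|_] /=; first by rewrite addn0.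
by rewrite andbT ltnNge.
Qed.

End Counting.

(** * The blow-up is a maximal forest of the product *)

Section BlowUp.
Variables (G H : sgraph) (H_empty : edgeless H) (X : {set G}) (h0 : H).
Local Notation F := (induced X).
Local Notation S := (val @: blown F).

Definition blow_up : {set lex_product G H} :=
  [set p : G * H | (p.1 \in X) && ((p.2 == h0) || (p.1 \in S))].

Lemma lex_adjE (p q : lex_product G H) : adj p q = adj p.1 q.1.
Proof. by rewrite /= /lex_adj (negPf (H_empty _ _)) andbF orbF. Qed.

Lemma mem_S (v : F) : (val v \in S) = (v \in blown F).
Proof. exact: mem_imset val_inj. Qed.

Lemma blow_up_forest : is_forest X -> is_forest blow_up.
Proof.
move=> /is_forestP forX; apply/is_forestP => c cY; apply/negP => cc.
have liftX p : p \in c -> exists v : F, val v = p.1.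
  by move/cY; rewrite inE => /andP[pX _]; exists (Sub p.1 pX).
have snd0 p : p \in c -> p.1 \notin S -> p.2 = h0.
  by move/cY; rewrite inE => /andP[_ /orP[/eqP//|->]].
(* Both cycle neighbours of a blown-up vertex lie over its only neighbour in [F]. That neighbour is
   not blown up, so it has a single copy and the two coincide. *)
have cS p : p \in c -> p.1 \notin S.
  move=> pc; apply/negP => pS.
  have [a [b [ac bc ab pa pb]]] := is_cycle_neighbours cc pc.
  have [v Dv] := liftX p pc; have [x Dx] := liftX a ac.
  have [y Dy] := liftX b bc.
  rewrite lex_adjE -Dv -Dx in pa; rewrite lex_adjE -Dv -Dy in pb.
  rewrite -Dv mem_S in pS.
  have vx : adj v x by []; have vy : adj v y by [].
  have aS : a.1 \notin S.
    by rewrite -Dx mem_S; apply: contraTN vx; apply: blown_independent.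
  have bS : b.1 \notin S.
    by rewrite -Dy mem_S; apply: contraTN vy; apply: blown_independent.
  have dv : degree v <= 1 by move: pS; rewrite inE => /andP[].
  have Dxy := degree1_uniq dv vx vy.
  case/negP: ab; apply/eqP; rewrite [a]surjective_pairing [b]surjective_pairing.
  by rewrite -Dx -Dy Dxy !snd0.
have /negP[] : ~~ is_cycle (map fst c : seq G).
  by apply: forX => x /mapP[p /cY + ->]; rewrite inE => /andP[].
(* Off [S] the second coordinate is always [h0], so the projection is injective on [c]. *)
apply: is_cycle_map cc => [p q pc qc e | p q _ _]; last by rewrite lex_adjE.
by rewrite [p]surjective_pairing [q]surjective_pairing e !snd0 ?cS.
Qed.

Lemma blow_up_maximal : maximal_forest X -> maximal_forest blow_up.
Proof.
move=> /maxsetP[forX maxX]; apply/maxsetP; split; first exact: blow_up_forest.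
move=> Z /is_forestP forZ YZ; apply/eqP; rewrite eqEsubset YZ andbT.
apply/subsetP => -[g h] ghZ; apply: contraT => ghY.
have XZ x : x \in X -> (x, h0) \in Z.
  by move=> xX; apply: (subsetP YZ); rewrite inE /= xX eqxx.
have [gX|gX] := boolP (g \in X); last first.
  (* By maximality of [X], adding [g] creates a cycle; it lifts to [Z] with [g] at level [h] and all
     other vertices at level [h0]. *)
  have : ~~ is_forest (g |: X).
    apply: contra gX => forgX; rewrite -(maxX _ forgX) ?setU11 //.
    exact: subsetUr.
  case/is_forestP => c cgX; apply/negP => cc.
  have /negP[] : ~~ is_cycle ([seq (x, if x == g then h else h0) | x <- c]
      : seq (lex_product G H)).
    apply: forZ => _ /mapP[x /cgX + ->]; rewrite in_setU1.
    by case: eqP => [-> _ //|_ /= /XZ].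
  apply: is_cycle_map cc => [x y _ _ [] //|x y _ _].
  by rewrite lex_adjE.
have := ghY; rewrite inE /= gX /= negb_or => /andP[hh0 gS].
pose v : F := Sub g gX; rewrite -[g]/(val v) mem_S in gS.
(* The copies [(g, h0)] and [(g, h)] and two distinct common neighbours form a 4-cycle; these
   neighbours may lie over the same vertex, at different levels. *)
have cyc4 (x y : F) k : adj v x -> adj v y -> (val y, k) \in Z ->
    (x, h0) != (y, k) -> False.
  move=> vx vy yZ xy.
  have vx' : adj g (val x) by []; have vy' : adj g (val y) by [].
  have /negP[] : ~~ is_cycle ([:: (g, h0); (val x, h0); (g, h); (val y, k)]
      : seq (lex_product G H)).
    apply: forZ => p; rewrite !inE => /or4P[]/eqP-> //; apply: XZ => //.
    exact: valP.
  apply: is_cycle4; rewrite ?lex_adjE //= 1?adj_sym //.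
  by apply: contraNneq hh0 => -[->].
have [dv|dv] := leqP (degree v) 1; last first.
  have /card_gt1P[x [y []]] := dv; rewrite !inE => vx vy xy.
  case: (cyc4 x y h0) => //; first exact/XZ/valP.
  by apply: contraNneq xy => -[->].
(* With degree at most 1 and not blown up, [v] is the nonroot end of a K2 component. The other end
   [w] is blown up, so its copies at [h0] and [h] are the two common neighbours. *)
move: gS; rewrite inE dv negb_imply /= => /andP[kv rv].
have [w [vw defC _]] := isK2_component kv.
have Dw : root adj v = w.
  have: root adj v \in component v by rewrite inE connect_root.
  by rewrite defC !inE (negPf rv) => /eqP.
have symF := sym_connect_sym (@adj_sym F).
have cw : component w = component v.
  by apply/component_eqP; rewrite (root_connect symF) symF connect1.
have wB : w \in blown F.
  have [|z [_ _ dw]] := @isK2_component _ w; first by rewrite cw.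
  by rewrite inE dw -Dw root_root // eqxx implybT.
case: (cyc4 w w h) => //.
  by apply: (subsetP YZ); rewrite inE /= mem_S wB orbT (valP w).
by apply: contraNneq hh0 => -[->].
Qed.

Lemma card_blow_up : #|blow_up| = #|H| * #|blown F| + #|~: blown F|.
Proof.
have SX : S \subset X by apply/subsetP => _ /imsetP[v _ ->]; apply: valP.
(* Disjoint pieces: full fibres over [S], one vertex over each remaining vertex of [X]. *)
have -> : blow_up = setX S [set: H] :|: setX (X :\: S) [set h0].
  apply/setP => -[g h]; rewrite !inE /= andbT.
  have := subsetP SX g; case: (g \in S) => [->|_]; rewrite ?orbT //=.
  by rewrite orbF.
rewrite cardsU !cardsX cardsT cards1 muln1 mulnC (eq_card0 (A := _ :&: _)).
  rewrite subn0 cardsD (setIidPr SX) card_imset; last exact: val_inj.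
  by rewrite [#|~: _|]cardsCs setCK card_sig.
by move=> [g h]; rewrite !inE /=; case: (g \in S); rewrite ?andbF.
Qed.

End BlowUp.

Theorem theorem3p2 (G H : sgraph) (n : nat)
  (n_gt0 : 0 < n) (H_order : #|H| = n) (H_empty : edgeless H)
  (GH_wfc : well_f_covered (lex_product G H))
  (X : {set G}) (X_max : maximal_forest X) :
  let F := induced X in
  n * (num_isolated F + num_K2 F + num_leaves F) + num_K2 F + num_internal F
    = forest_number (lex_product G H).
Proof.
(* Positivity of [n] supplies the level [h0] of the single copies. *)
move=> F; have /card_gt0P[h0 _] : 0 < #|H| by rewrite H_order.
rewrite -(maximal_forest_card GH_wfc (blow_up_maximal H_empty h0 X_max)).
by rewrite card_blow_up H_order card_blown card_blownC addnA.
Qed.
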